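(* Let $(\mathcal{P},\mu,\Delta)$ be a finite-dimensional partially associative $3$-ary infinitesimal bialgebra over $\mathcal{K}$. Then $(\mathcal{P}^{*},\Delta^{*},\mu^{*})$ is a partially associative $3$-ary infinitesimal bialgebra.
   Context: $\mathcal{K}$ is a fixed field of characteristic zero. A partially associative $3$-ary infinitesimal bialgebra is a triple $(\mathcal{A},\mu,\Delta)$ with $\mu:\mathcal{A}^{\otimes3}\to\mathcal{A}$ and $\Delta:\mathcal{A}\to\mathcal{A}^{\otimes3}$ linear such that: (1) $\mu\circ(\mu\otimes\mathrm{id}\otimes\mathrm{id}+\mathrm{id}\otimes\mu\otimes\mathrm{id}+\mathrm{id}\otimes\mathrm{id}\otimes\mu)=0$ (partially associative $3$-ary algebra); (2) $(\Delta\otimes\mathrm{id}\otimes\mathrm{id}+\mathrm{id}\otimes\Delta\otimes\mathrm{id}+\mathrm{id}\otimes\mathrm{id}\otimes\Delta)\circ\Delta=0$ (partially coassociative $3$-ary coalgebra); (3) for all $x,y,z\in\mathcal{A}$, $\Delta\mu(x,y,z)=(L_\mu(x,y)\otimes\mathrm{id}\otimes\mathrm{id})\Delta(z)+(\mathrm{id}\otimes M_\mu(x,z)\otimes\mathrm{id})\Delta(y)+(\mathrm{id}\otimes\mathrm{id}\otimes R_\mu(y,z))\Delta(x)$, where $L_\mu(x,y)(z)=\mu(x,y,z)$, $M_\mu(x,y)(z)=\mu(x,z,y)$, $R_\mu(x,y)(z)=\mu(z,x,y)$. The dual maps $\Delta^*:(\mathcal{P}^* )^{\otimes3}\to\mathcal{P}^*$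 (the product on $\mathcal{P}^*$) and $\mu^*:\mathcal{P}^*\to(\mathcal{P}^* )^{\otimes3}$ (the coproduct on $\mathcal{P}^*$) are given by $\langle\Delta^*(\xi,\eta,\gamma),x\rangle=\langle\xi\otimes\eta\otimes\gamma,\Delta(x)\rangle$ and $\langle\mu^*(\xi),x\otimes y\otimes z\rangle=\langle\xi,\mu(x,y,z)\rangle$, with $\langle\xi\otimes\eta\otimes\gamma,x\otimes y\otimes z\rangle=\xi(x)\eta(y)\gamma(z)$. *)

(* Defs.v *)
From HB Require Import structures.
From mathcomp Require Import all_boot all_algebra.
From mathcomp Require Import boolp classical_sets.
From mathcomp Require Import freeg.

Set Implicit Arguments.
Unset Strict Implicit.
Unset Printing Implicit Defensive.

Import GRing.Theory.

Local Open Scope ring_scope.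
Local Open Scope quotient_scope.

(** The tensor product, in arbitrary dimension, is the free vector space on
    [U * V] modulo the bilinearity relations. *)

Section TensorProduct.
Variables (K : fieldType) (U V : lmodType K).

Definition tensor_gen (u : U) (v : V) : {freeg (U * V)%type / K} :=
  Freeg [:: (1, (u, v))].

Inductive tensor_rel : {freeg (U * V)%type / K} -> Prop :=
| tensor_rel_left a u u' v : tensor_rel
    (tensor_gen (a *: u + u') v - (a *: tensor_gen u v + tensor_gen u' v))
| tensor_rel_right a u v v' : tensor_rel
    (tensor_gen u (a *: v + v') - (a *: tensor_gen u v + tensor_gen u v'))
| tensor_rel0 : tensor_rel 0
| tensor_relP a s t : tensor_rel s -> tensor_rel t -> tensor_rel (a *: s + t).

Definition tensor_ker : {pred {freeg (U * V)%type / K}} :=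
  fun t => `[< tensor_rel t >].

Lemma tensor_kerP t : reflect (tensor_rel t) (t \in tensor_ker).
Proof. exact: asboolP. Qed.

Lemma tensor_ker_zmod : zmod_closed tensor_ker.
Proof.
split; first by apply/tensor_kerP/tensor_rel0.
move=> s t /tensor_kerP hs /tensor_kerP ht; apply/tensor_kerP.
by rewrite addrC -scaleN1r; apply: tensor_relP.
Qed.

HB.instance Definition _ :=
  GRing.isZmodClosed.Build _ tensor_ker tensor_ker_zmod.

Lemma tensor_kerZ a t : t \in tensor_ker -> a *: t \in tensor_ker.
Proof.
move=> /tensor_kerP ht; apply/tensor_kerP.
by rewrite -[_ *: _]addr0; apply: tensor_relP => //; apply: tensor_rel0.
Qed.

Definition tensor : Type := Quotient.quot tensor_ker.

HB.instance Definition _ := Choice.on tensor.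
HB.instance Definition _ := Quotient.on tensor.

(** The operations of the quotient, locked for the efficiency of unification. *)
Fact tensor_key : unit. Proof. by []. Qed.
Definition tensor_add : tensor -> tensor -> tensor :=
  locked_with tensor_key (@Quotient.add _ tensor_ker).
Definition tensor_opp : tensor -> tensor :=
  locked_with tensor_key (@Quotient.opp _ tensor_ker).
Definition tensor_zero : tensor :=
  locked_with tensor_key (Quotient.zero tensor_ker).

Lemma tensor_addA : associative tensor_add.
Proof. by rewrite /tensor_add unlock; apply: Quotient.addqA. Qed.

Lemma tensor_addC : commutative tensor_add.
Proof. by rewrite /tensor_add unlock; apply: Quotient.addqC. Qed.

Lemma tensor_add0 : left_id tensor_zero tensor_add.
Proof.
by rewrite /tensor_add /tensor_zero !unlock; apply: Quotient.add0q.
Qed.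

Lemma tensor_addN : left_inverse tensor_zero tensor_opp tensor_add.
Proof.
rewrite /tensor_add /tensor_zero /tensor_opp !unlock.
exact: Quotient.addNq.
Qed.

HB.instance Definition _ := GRing.isZmodule.Build tensor
  tensor_addA tensor_addC tensor_add0 tensor_addN.

Definition tensor_pi (t : {freeg (U * V)%type / K}) : tensor := \pi_tensor t.

Lemma tensor_piP s t : (tensor_pi s = tensor_pi t) <-> tensor_rel (s - t).
Proof.
split=> [/eqP|h].
  by rewrite /tensor_pi -(Quotient.idealrBE tensor_ker) => /tensor_kerP.
by apply/eqP; rewrite /tensor_pi -(Quotient.idealrBE tensor_ker); apply/tensor_kerP.
Qed.

Lemma tensor_piD s t : tensor_pi (s + t) = tensor_pi s + tensor_pi t.
Proof.
rewrite [RHS]/(tensor_add _ _) /tensor_add unlock.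
exact: (@Quotient.pi_add _ tensor_ker s t).
Qed.

Lemma tensor_piK t : tensor_pi (repr t) = t.
Proof. exact: reprK. Qed.

Definition tensor_scale (a : K) (t : tensor) : tensor :=
  locked_with tensor_key (tensor_pi (a *: repr t)).

Lemma tensor_piZ a t : tensor_pi (a *: t) = tensor_scale a (tensor_pi t).
Proof.
rewrite /tensor_scale unlock; apply/tensor_piP; rewrite -scalerBr.
apply/tensor_kerP/tensor_kerZ/tensor_kerP.
by apply/tensor_piP; rewrite tensor_piK.
Qed.

Lemma tensor_scaleA a b t :
  tensor_scale a (tensor_scale b t) = tensor_scale (a * b) t.
Proof. by rewrite -[t]tensor_piK -!tensor_piZ scalerA. Qed.

Lemma tensor_scale1 t : tensor_scale 1 t = t.
Proof. by rewrite -[t]tensor_piK -!tensor_piZ scale1r. Qed.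

Lemma tensor_scaleDr : right_distributive tensor_scale +%R.
Proof.
move=> a s t; rewrite -[s]tensor_piK -[t]tensor_piK.
by rewrite -tensor_piD -!tensor_piZ scalerDr tensor_piD.
Qed.

Lemma tensor_scaleDl t : {morph tensor_scale^~ t : a b / a + b}.
Proof.
by move=> a b; rewrite -[t]tensor_piK -!tensor_piZ scalerDl tensor_piD.
Qed.

HB.instance Definition _ := GRing.Zmodule_isLmodule.Build K tensor
  tensor_scaleA tensor_scale1 tensor_scaleDr tensor_scaleDl.

Lemma tensor_pi_linear : linear tensor_pi.
Proof. by move=> a s t; rewrite tensor_piD tensor_piZ. Qed.

HB.instance Definition _ :=
  GRing.isLinear.Build K _ tensor _ tensor_pi tensor_pi_linear.

Definition tpure (u : U) (v : V) : tensor := tensor_pi (tensor_gen u v).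

Lemma tpure_bilinear : bilinear_for *:%R *:%R tpure.
Proof.
split=> [v|u] a x y /=; rewrite /tpure -linearP; apply/tensor_piP.
  exact: tensor_rel_left.
exact: tensor_rel_right.
Qed.

HB.instance Definition _ := bilinear_isBilinear.Build K U V tensor
  *:%R *:%R tpure tpure_bilinear.
HB.instance Definition _ u :=
  GRing.isLinear.Build K V tensor _ (tpure u) (tpure_bilinear.2 u).

Lemma tensor_ind (Q : tensor -> Prop) :
    Q 0 -> (forall a u v t, Q t -> Q (a *: tpure u v + t)) ->
  forall t, Q t.
Proof.
move=> Q0 QD t; rewrite -[t]tensor_piK -[repr t]freeg_sumE.
elim: (dom _) => [|[u v] s IHs]; first by rewrite big_nil raddf0.
rewrite big_cons raddfD /=; set c := coeff _ _.
suff -> : tensor_pi (Freeg [:: (c, (u, v))]) = c *: tpure u v.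
  exact: QD.
rewrite /tpure -linearZ; congr tensor_pi; apply/eqP/freeg_eqP => z.
by rewrite coeffZ !coeffU mul1r.
Qed.

End TensorProduct.

Arguments tpure {K U V} u v.

Notation "U ⊗ V" := (tensor U V)
  (at level 40, V at level 39, no associativity) : type_scope.
Notation "u ⊗ₜ v" := (tpure u v)
  (at level 40, v at level 39, no associativity) : ring_scope.

Lemma tensor_ext (K : fieldType) (U V W : lmodType K)
    (f g : {linear U ⊗ V -> W}) :
  (forall u v, f (u ⊗ₜ v) = g (u ⊗ₜ v)) -> f =1 g.
Proof.
move=> fg; elim/tensor_ind => [|a u v t IHt]; first by rewrite !raddf0.
by rewrite !linearP fg IHt.
Qed.

Section TensorLift.
Variables (K : fieldType) (U V W : lmodType K) (f : {bilinear U -> V -> W}).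

(** Independent of the representative; see [tlift_pure]. *)
Definition tlift (t : U ⊗ V) : W := fglift (fun p => f p.1 p.2) (repr t).

Let lift0 (t : {freeg (U * V)%type / K}) : W :=
  fglift (fun p => f p.1 p.2) t.

Let lift0_gen u v : lift0 (tensor_gen u v) = f u v.
Proof. by rewrite /lift0 liftU scale1r. Qed.

Let lift0B s t : lift0 (s - t) = lift0 s - lift0 t.
Proof. exact: lift_is_additive. Qed.

Let lift00 : lift0 0 = 0.
Proof. by rewrite -(subrr 0) lift0B subrr. Qed.

Let lift0D s t : lift0 (s + t) = lift0 s + lift0 t.
Proof. by rewrite -{1}[t]opprK -[- t]add0r !lift0B lift00 sub0r opprK. Qed.

Let lift0Z a t : lift0 (a *: t) = a *: lift0 t.
Proof.
rewrite -[t]freeg_sumE scaler_sumr.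
elim: (dom t) => [|p s IHs]; first by rewrite !big_nil lift00 scaler0.
rewrite !big_cons !lift0D IHs scalerDr; congr (_ + _).
set c := coeff p t.
have -> : a *: Freeg [:: (c, p)] = Freeg [:: (a * c, p)].
  by apply/eqP/freeg_eqP => z; rewrite coeffZ !coeffU mulrA.
by rewrite /lift0 !liftU scalerA.
Qed.

Let lift0_ker t : tensor_rel t -> lift0 t = 0.
Proof.
elim=> [a u u' v|a u v v'||a s s' _ hs _ hs'].
- by rewrite lift0B lift0D lift0Z !lift0_gen linearPl subrr.
- by rewrite lift0B lift0D lift0Z !lift0_gen linearPr subrr.
- exact: lift00.
- by rewrite lift0D lift0Z hs hs' scaler0 addr0.
Qed.

Let tlift_pi t : tlift (tensor_pi t) = lift0 t.
Proof.
apply/eqP; rewrite -subr_eq0; apply/eqP.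
rewrite -[tlift _]/(lift0 _) -lift0B; apply/lift0_ker/tensor_piP.
by rewrite tensor_piK.
Qed.

Lemma tlift_linear : linear tlift.
Proof.
move=> a s t; rewrite -[s]tensor_piK -[t]tensor_piK -linearP !tlift_pi.
by rewrite lift0D lift0Z.
Qed.

HB.instance Definition _ :=
  GRing.isLinear.Build K (U ⊗ V) W _ tlift tlift_linear.

Lemma tlift_pure u v : tlift (u ⊗ₜ v) = f u v.
Proof. by rewrite /tpure tlift_pi lift0_gen. Qed.

End TensorLift.

Section TensorMap.
Variables (K : fieldType) (U V U' V' : lmodType K).

Section Map.
Variables (f : {linear U -> U'}) (g : {linear V -> V'}).

Definition tmap_fun (u : U) (v : V) : U' ⊗ V' := f u ⊗ₜ g v.

Lemma tmap_fun_bilinear : bilinear_for *:%R *:%R tmap_fun.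
Proof.
by split=> [v|u] a x y /=; rewrite /tmap_fun linearP /= (linearPl, linearPr).
Qed.

HB.instance Definition _ := bilinear_isBilinear.Build K U V (U' ⊗ V')
  *:%R *:%R tmap_fun tmap_fun_bilinear.

Definition tmap : U ⊗ V -> U' ⊗ V' := tlift tmap_fun.

HB.instance Definition _ := GRing.isLinear.Build K (U ⊗ V) (U' ⊗ V') _
  tmap (tlift_linear _).

Lemma tmap_pure u v : tmap (u ⊗ₜ v) = f u ⊗ₜ g v.
Proof. exact: tlift_pure. Qed.

End Map.
End TensorMap.

Section TensorAssoc.
Variables (K : fieldType) (U V W : lmodType K).

Definition tassoc_fun (s : U ⊗ V) (w : W) : U ⊗ (V ⊗ W) :=
  tmap idfun (applyr tpure w) s.

Lemma tassoc_fun_bilinear : bilinear_for *:%R *:%R tassoc_fun.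
Proof.
split=> [w|s] a x y /=; first by rewrite /tassoc_fun linearP.
elim/tensor_ind: s => [|b u v t IHt]; rewrite /tassoc_fun ?raddf0 ?scaler0 ?addr0 //.
rewrite !linearP /= !tmap_pure /= !linearPr /=.
rewrite -!/(tassoc_fun _ _) IHt !scalerDr !scalerA -!addrA mulrC.
by congr (_ + _); rewrite addrCA.
Qed.

HB.instance Definition _ := bilinear_isBilinear.Build K (U ⊗ V) W
  (U ⊗ (V ⊗ W)) *:%R *:%R tassoc_fun tassoc_fun_bilinear.

Definition tassoc : (U ⊗ V) ⊗ W -> U ⊗ (V ⊗ W) := tlift tassoc_fun.

HB.instance Definition _ := GRing.isLinear.Build K ((U ⊗ V) ⊗ W)
  (U ⊗ (V ⊗ W)) _ tassoc (tlift_linear _).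

Lemma tassoc_pure u v w : tassoc ((u ⊗ₜ v) ⊗ₜ w) = u ⊗ₜ (v ⊗ₜ w).
Proof. by rewrite /tassoc tlift_pure /= /tassoc_fun tmap_pure. Qed.

Definition tassocV_fun (u : U) (t : V ⊗ W) : (U ⊗ V) ⊗ W :=
  tmap (tpure u) idfun t.

Lemma tassocV_fun_bilinear : bilinear_for *:%R *:%R tassocV_fun.
Proof.
split=> [s|u] a x y /=; last by rewrite /tassocV_fun linearP.
elim/tensor_ind: s => [|b v w t IHt]; rewrite /tassocV_fun ?raddf0 ?scaler0 ?addr0 //.
rewrite !linearP /= !tmap_pure /= linearPl linearPl /=.
rewrite -!/(tassocV_fun _ _) IHt !scalerDr !scalerA -!addrA mulrC.
by congr (_ + _); rewrite addrCA.
Qed.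

HB.instance Definition _ := bilinear_isBilinear.Build K U (V ⊗ W)
  ((U ⊗ V) ⊗ W) *:%R *:%R tassocV_fun tassocV_fun_bilinear.

Definition tassocV : U ⊗ (V ⊗ W) -> (U ⊗ V) ⊗ W := tlift tassocV_fun.

HB.instance Definition _ := GRing.isLinear.Build K (U ⊗ (V ⊗ W))
  ((U ⊗ V) ⊗ W) _ tassocV (tlift_linear _).

Lemma tassocV_pure u v w : tassocV (u ⊗ₜ (v ⊗ₜ w)) = (u ⊗ₜ v) ⊗ₜ w.
Proof. by rewrite /tassocV tlift_pure /= /tassocV_fun tmap_pure. Qed.

End TensorAssoc.

Section ThreefoldTensor.
Variable K : fieldType.

(** Tensor powers are bracketed to the right, so the third power of [A] is
    [A ⊗ (A ⊗ A)] and the fifth is [A ⊗ (A ⊗ (A ⊗ (A ⊗ A)))]. The maps below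
    rebracket a threefold product occurring as a left factor. *)
Definition tassoc3 (U V W X : lmodType K) :
    (U ⊗ (V ⊗ W)) ⊗ X -> U ⊗ (V ⊗ (W ⊗ X)) :=
  tmap idfun (@tassoc K V W X) \o @tassoc K U (V ⊗ W) X.

Definition tassoc3V (U V W X : lmodType K) :
    U ⊗ (V ⊗ (W ⊗ X)) -> (U ⊗ (V ⊗ W)) ⊗ X :=
  @tassocV K U (V ⊗ W) X \o tmap idfun (@tassocV K V W X).

HB.instance Definition _ (U V W X : lmodType K) :=
  GRing.Linear.on (@tassoc3 U V W X).
HB.instance Definition _ (U V W X : lmodType K) :=
  GRing.Linear.on (@tassoc3V U V W X).

Lemma tassoc3_pure (U V W X : lmodType K) (u : U) (v : V) (w : W) (x : X) :
  tassoc3 ((u ⊗ₜ (v ⊗ₜ w)) ⊗ₜ x) = u ⊗ₜ (v ⊗ₜ (w ⊗ₜ x)).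
Proof. by rewrite /tassoc3 /= tassoc_pure tmap_pure /= tassoc_pure. Qed.

Lemma tassoc3V_pure (U V W X : lmodType K) (u : U) (v : V) (w : W) (x : X) :
  tassoc3V (u ⊗ₜ (v ⊗ₜ (w ⊗ₜ x))) = (u ⊗ₜ (v ⊗ₜ w)) ⊗ₜ x.
Proof. by rewrite /tassoc3V /= tmap_pure /= tassocV_pure tassocV_pure. Qed.

End ThreefoldTensor.

Notation cube A := (A ⊗ (A ⊗ A))%type.

Section Bialgebra.
Variables (K : fieldType) (A : lmodType K).
Variables (mu : {linear cube A -> A}) (Delta : {linear A -> cube A}).

Definition opL (x y z : A) : A := mu (x ⊗ₜ (y ⊗ₜ z)).
Definition opM (x y z : A) : A := mu (x ⊗ₜ (z ⊗ₜ y)).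
Definition opR (x y z : A) : A := mu (z ⊗ₜ (x ⊗ₜ y)).

Lemma opL_linear x y : linear (opL x y).
Proof. by move=> a z t; rewrite /opL !linearPr linearP. Qed.

Lemma opM_linear x y : linear (opM x y).
Proof. by move=> a z t; rewrite /opM linearPl linearPr linearP. Qed.

Lemma opR_linear x y : linear (opR x y).
Proof. by move=> a z t; rewrite /opR linearPl linearP. Qed.

HB.instance Definition _ x y :=
  GRing.isLinear.Build K A A _ (opL x y) (opL_linear x y).
HB.instance Definition _ x y :=
  GRing.isLinear.Build K A A _ (opM x y) (opM_linear x y).
HB.instance Definition _ x y :=
  GRing.isLinear.Build K A A _ (opR x y) (opR_linear x y).

(** The three summands are [mu ⊗ id ⊗ id], [id ⊗ mu ⊗ id] and [id ⊗ id ⊗ mu]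
    on the fifth tensor power; see [partially_associativeP]. *)
Definition partially_associative : Prop :=
  mu \o ((tmap mu idfun \o @tassoc3V K A A A (A ⊗ A))
         \+ tmap idfun (tmap mu idfun \o @tassoc3V K A A A A)
         \+ tmap idfun (tmap idfun mu)) =1 \0.

Definition partially_coassociative : Prop :=
  ((@tassoc3 K A A A (A ⊗ A) \o tmap Delta idfun)
     \+ tmap idfun (@tassoc3 K A A A A \o tmap Delta idfun)
     \+ tmap idfun (tmap idfun Delta)) \o Delta =1 \0.

Lemma partially_associativeP : partially_associative <->
  forall x1 x2 x3 x4 x5 : A,
    mu (mu (x1 ⊗ₜ (x2 ⊗ₜ x3)) ⊗ₜ (x4 ⊗ₜ x5))
    + mu (x1 ⊗ₜ (mu (x2 ⊗ₜ (x3 ⊗ₜ x4)) ⊗ₜ x5))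
    + mu (x1 ⊗ₜ (x2 ⊗ₜ mu (x3 ⊗ₜ (x4 ⊗ₜ x5)))) = 0.
Proof.
rewrite /partially_associative; set g := (X in mu \o X).
have gE x1 x2 x3 x4 x5 : mu (g (x1 ⊗ₜ (x2 ⊗ₜ (x3 ⊗ₜ (x4 ⊗ₜ x5))))) =
    mu (mu (x1 ⊗ₜ (x2 ⊗ₜ x3)) ⊗ₜ (x4 ⊗ₜ x5))
    + mu (x1 ⊗ₜ (mu (x2 ⊗ₜ (x3 ⊗ₜ x4)) ⊗ₜ x5))
    + mu (x1 ⊗ₜ (x2 ⊗ₜ mu (x3 ⊗ₜ (x4 ⊗ₜ x5)))).
  by rewrite /g /= tassoc3V_pure !tmap_pure /= tassoc3V_pure !tmap_pure !linearD.
split=> [f0 x1 x2 x3 x4 x5|E]; first by rewrite -gE; exact: f0.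
apply: (tensor_ext (f := mu \o g) (g := \0)) => x1.
apply: (tensor_ext (f := mu \o g \o tpure x1) (g := \0)) => x2.
apply: (tensor_ext (f := mu \o g \o tpure x1 \o tpure x2) (g := \0)) => x3.
apply: (tensor_ext (f := mu \o g \o tpure x1 \o tpure x2 \o tpure x3)
  (g := \0)) => x4 x5.
by rewrite /= gE E.
Qed.

Definition infinitesimal_compatible : Prop := forall x y z : A,
  Delta (mu (x ⊗ₜ (y ⊗ₜ z))) =
    tmap (opL x y) idfun (Delta z)
    + tmap idfun (tmap (opM x z) idfun) (Delta y)
    + tmap idfun (tmap idfun (opR y z)) (Delta x).

Record pa3_inf_bialgebra : Prop := Pa3InfBialgebra {
  pa3_assoc : partially_associative;
  pa3_coassoc : partially_coassociative;
  pa3_compat : infinitesimal_compatible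
}.

End Bialgebra.

Section Pairing.
Variables (K : fieldType) (U V U' V' : lmodType K).
Variables (b : {bilinear U -> U' -> K^o}) (c : {bilinear V -> V' -> K^o}).

Section Inner.
Variables (u : U) (v : V).

Definition tpair_inner (u' : U') (v' : V') : K^o := b u u' * c v v'.

Lemma tpair_inner_bilinear : bilinear_for *:%R *:%R tpair_inner.
Proof.
split=> [v'|u'] a x y /=; rewrite /tpair_inner linearPr /=.
  by rewrite mulrDl -scalerAl.
by rewrite mulrDr -scalerAr.
Qed.

HB.instance Definition _ := bilinear_isBilinear.Build K U' V' K^o
  *:%R *:%R tpair_inner tpair_inner_bilinear.
End Inner.

Definition tpair_outer (t : U' ⊗ V') (u : U) (v : V) : K^o :=
  tlift (tpair_inner u v) t.

Lemma tpair_outer_bilinear t : bilinear_for *:%R *:%R (tpair_outer t).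
Proof.
split=> [v|u] a x y /=; rewrite /tpair_outer.
  have E u' v' : tpair_inner (a *: x + y) v u' v'
      = a *: tpair_inner x v u' v' + tpair_inner y v u' v'.
    by rewrite /tpair_inner linearPl /= mulrDl -scalerAl.
  elim/tensor_ind: t => [|k u' v' t IHt]; rewrite ?raddf0 ?scaler0 ?addr0 //.
  rewrite !linearP /= IHt !tlift_pure /= E.
  by rewrite !scalerDr !scalerA mulrC addrACA.
have E u' v' : tpair_inner u (a *: x + y) u' v'
    = a *: tpair_inner u x u' v' + tpair_inner u y u' v'.
  by rewrite /tpair_inner linearPl /= mulrDr -scalerAr.
elim/tensor_ind: t => [|k u' v' t IHt]; rewrite ?raddf0 ?scaler0 ?addr0 //.
rewrite !linearP /= IHt !tlift_pure /= E.
by rewrite !scalerDr !scalerA mulrC addrACA.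
Qed.

HB.instance Definition _ t := bilinear_isBilinear.Build K U V K^o
  *:%R *:%R (tpair_outer t) (tpair_outer_bilinear t).

(** The pairing [<u ⊗ v, u' ⊗ v'> = b u u' * c v v'] of tensor products. *)
Definition tpair (s : U ⊗ V) (t : U' ⊗ V') : K^o := tlift (tpair_outer t) s.

Lemma tpair_pure u v u' v' :
  tpair (u ⊗ₜ v) (u' ⊗ₜ v') = b u u' * c v v'.
Proof. by rewrite /tpair tlift_pure /= /tpair_outer tlift_pure. Qed.

Lemma tpair_bilinear : bilinear_for *:%R *:%R tpair.
Proof.
split=> [t|s] a x y /=; rewrite /tpair; first by rewrite linearP.
elim/tensor_ind: s => [|k u v s IHs]; rewrite ?raddf0 ?scaler0 ?addr0 //.
rewrite !linearP /= IHs !tlift_pure /= {1}/tpair_outer linearP /=.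
by rewrite !scalerDr !scalerA mulrC addrACA.
Qed.

HB.instance Definition _ := bilinear_isBilinear.Build K (U ⊗ V) (U' ⊗ V') K^o
  *:%R *:%R tpair tpair_bilinear.

End Pairing.

Definition has_dual_bases (K : fieldType) (U U' : lmodType K)
    (b : U -> U' -> K^o) : Prop :=
  exists (I : finType) (e : I -> U) (e' : I -> U'),
    (forall u, u = \sum_i b u (e' i) *: e i) /\
    (forall u', u' = \sum_i b (e i) u' *: e' i).

Lemma tpair_dual_bases (K : fieldType) (U V U' V' : lmodType K)
    (b : {bilinear U -> U' -> K^o}) (c : {bilinear V -> V' -> K^o}) :
  has_dual_bases b -> has_dual_bases c -> has_dual_bases (tpair b c).
Proof.
move=> [I [e [e' [eP e'P]]]] [J [f [f' [fP f'P]]]].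
exists (I * J)%type, (fun p => e p.1 ⊗ₜ f p.2), (fun p => e' p.1 ⊗ₜ f' p.2).
split; elim/tensor_ind => [|a u v t IHt].
- by rewrite big1 // => p _; rewrite linear0l scale0r.
- under eq_bigr do rewrite linearPl scalerDl.
  rewrite big_split /= -IHt; congr (_ + _).
  under eq_bigr do rewrite tpair_pure -scalerA.
  rewrite -scaler_sumr; congr (_ *: _).
  rewrite {1}(eP u) {1}(fP v) linear_sumlz /=.
  rewrite -(pair_bigA _ (fun i j => (b u (e' i) * c v (f' j) : K) *: (e i ⊗ₜ f j))) /=.
  apply: eq_bigr => i _; rewrite linear_sumr; apply: eq_bigr => j _.
  by rewrite linearZl linearZr /= scalerA.
- by rewrite big1 // => p _; rewrite linear0r scale0r.
- under eq_bigr do rewrite linearPr scalerDl.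
  rewrite big_split /= -IHt; congr (_ + _).
  under eq_bigr do rewrite tpair_pure -scalerA.
  rewrite -scaler_sumr; congr (_ *: _).
  rewrite {1}(e'P u) {1}(f'P v) linear_sumlz /=.
  rewrite -(pair_bigA _ (fun i j => (b (e i) u * c (f j) v : K) *: (e' i ⊗ₜ f' j))) /=.
  apply: eq_bigr => i _; rewrite linear_sumr; apply: eq_bigr => j _.
  by rewrite linearZl linearZr /= scalerA.
Qed.

Section Dual.
Variables (K : fieldType) (P : vectType K).

Definition dual : vectType K := 'Hom(P, K^o).

Definition dpair (xi : dual) (x : P) : K^o := xi x.

Lemma dpair_bilinear : bilinear_for *:%R *:%R dpair.
Proof.
split=> [x|xi] a y z /=; rewrite /dpair; last by rewrite linearP.
by rewrite add_lfunE scale_lfunE.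
Qed.

HB.instance Definition _ := bilinear_isBilinear.Build K dual P K^o
  *:%R *:%R dpair dpair_bilinear.

Lemma dpair_dual_bases : has_dual_bases dpair.
Proof.
pose X := vbasis {:P}.
have XE u : u = \sum_i coord X i u *: X`_i.
  exact/coord_vbasis/memvf.
exists 'I_(\dim {:P}), (fun i => linfun (coord X i : P -> K^o) : dual),
  (fun i : 'I__ => X`_i).
split=> [xi|x]; last first.
  rewrite {1}(XE x); apply: eq_bigr => i _.
  by rewrite /dpair lfunE.
apply/lfunP => x; rewrite {1}(XE x) linear_sum sum_lfunE.
by apply: eq_bigr => i _; rewrite scale_lfunE lfunE linearZ; apply: mulrC.
Qed.

Definition dpair3 : cube dual -> cube P -> K^o :=
  tpair dpair (tpair dpair dpair).

HB.instance Definition _ := Bilinear.on dpair3.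

Lemma dpair3_pure (xi eta gamma : dual) (x y z : P) :
  dpair3 (xi ⊗ₜ (eta ⊗ₜ gamma)) (x ⊗ₜ (y ⊗ₜ z)) = xi x * (eta y * gamma z).
Proof. by rewrite /dpair3 tpair_pure /= tpair_pure. Qed.

Lemma dpair3_dual_bases : has_dual_bases dpair3.
Proof.
by do !apply: tpair_dual_bases; apply: dpair_dual_bases.
Qed.

End Dual.

Section DualMaps.
Variables (K : fieldType) (P : vectType K).
Variables (mu : {linear cube P -> P}) (Delta : {linear P -> cube P}).

Definition dual_prod_fun (t : cube (dual P)) (x : P) : K^o :=
  dpair3 t (Delta x).

Lemma dual_prod_fun_linear t : linear (dual_prod_fun t).
Proof. by move=> a x y; rewrite /dual_prod_fun linearP linearPr /=. Qed.

HB.instance Definition _ t := GRing.isLinear.Build K P K^o _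
  (dual_prod_fun t) (dual_prod_fun_linear t).

Definition dual_prod (t : cube (dual P)) : dual P := linfun (dual_prod_fun t).

Lemma dual_prodE t x : dual_prod t x = dpair3 t (Delta x).
Proof. by rewrite lfunE. Qed.

Lemma dual_prod_linear : linear dual_prod.
Proof.
move=> a s t; apply/lfunP => x.
by rewrite add_lfunE scale_lfunE !dual_prodE linearPl.
Qed.

HB.instance Definition _ := GRing.isLinear.Build K (cube (dual P)) (dual P) _
  dual_prod dual_prod_linear.

Definition is_dual_coprod (xi : dual P) (t : cube (dual P)) : Prop :=
  forall x y z : P,
    dpair3 t (x ⊗ₜ (y ⊗ₜ z)) = xi (mu (x ⊗ₜ (y ⊗ₜ z))).

(** The unique such tensor: existence (which needs [P] finite-dimensional) and
    uniqueness are [is_dual_coprod_ex] and [is_dual_coprod_inj], so the default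
    value [0] is never used. *)
Definition dual_coprod (xi : dual P) : cube (dual P) :=
  xget 0 [set t | is_dual_coprod xi t].

Lemma is_dual_coprodE xi t :
  is_dual_coprod xi t -> forall s, dpair3 t s = xi (mu s).
Proof.
move=> ht; elim/tensor_ind => [|a x v s IHs].
  by rewrite linear0r !linear0.
rewrite linearPr /= IHs !linearP; congr (_ *: _ + _) => {s IHs}.
elim/tensor_ind: v => [|b y z v IHv]; first by rewrite !linear0r !linear0.
by rewrite !linearPr /= IHv ht !linearP.
Qed.

Lemma is_dual_coprod_inj xi t t' :
  is_dual_coprod xi t -> is_dual_coprod xi t' -> t = t'.
Proof.
move=> /is_dual_coprodE ht /is_dual_coprodE ht'.
have [I [e [e' [eP _]]]] := dpair3_dual_bases P.
by rewrite (eP t) (eP t'); apply: eq_bigr => i _; rewrite ht ht'.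
Qed.

Lemma is_dual_coprod_ex xi : exists t, is_dual_coprod xi t.
Proof.
have [I [e [e' [_ e'P]]]] := dpair3_dual_bases P.
exists (\sum_i (xi (mu (e' i)) : K) *: e i) => x y z.
set s := _ ⊗ₜ _; rewrite linear_sumlz [in RHS](e'P s) !linear_sum /=.
by apply: eq_bigr => i _; rewrite linearZl_LR !linearZ /= [LHS]mulrC.
Qed.

Lemma dual_coprodP xi : is_dual_coprod xi (dual_coprod xi).
Proof. exact: (xgetPex _ (is_dual_coprod_ex xi)). Qed.

Lemma dual_coprodE xi s : dpair3 (dual_coprod xi) s = xi (mu s).
Proof. exact/is_dual_coprodE/dual_coprodP. Qed.

Lemma dual_coprod_linear : linear dual_coprod.
Proof.
move=> a xi eta; apply: (is_dual_coprod_inj (dual_coprodP _)) => x y z.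
by rewrite linearPl /= !dual_coprodE add_lfunE scale_lfunE.
Qed.

HB.instance Definition _ := GRing.isLinear.Build K (dual P) (cube (dual P)) _
  dual_coprod dual_coprod_linear.

End DualMaps.

(* Main.v *)
(** Both structures on the dual are adjoints for the canonical pairings, and
    adjunction is compatible with sums, composition, tensor products and
    rebracketing. Hence the associativity sum of [Delta^*] is the adjoint of the
    coassociativity sum of [Delta], and the coassociativity sum of [mu^*] that of
    the associativity sum of [mu]; both vanish as the pairings are nondegenerate.
    For compatibility, pair with [x ⊗ y ⊗ z] and let [g] be the adjoint of
    [L(xi, eta)], so that [delta (g x) = <xi ⊗ eta ⊗ delta, Delta x>]. Then
    [<(L(xi, eta) ⊗ id ⊗ id) (mu^* gamma), x ⊗ y ⊗ z> = gamma (mu (g x, y, z))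
     = (gamma \o R(y, z)) (g x)
     = <xi ⊗ eta ⊗ gamma, (id ⊗ id ⊗ R(y, z)) (Delta x)>];
    [M] is matched with [M] and [R] with [L] in the same way. *)

Require Import Defs.
From HB Require Import structures.
From mathcomp Require Import all_boot all_algebra.

Set Implicit Arguments.
Unset Strict Implicit.
Unset Printing Implicit Defensive.

Import GRing.Theory.
Local Open Scope ring_scope.

(** * Adjoint maps for bilinear pairings, and their calculus *)

Definition adjoint (K : fieldType) (U V U' V' : lmodType K)
    (b : U -> U' -> K^o) (c : V -> V' -> K^o) (f : U -> V) (g : V' -> U') :=
  forall u v', c (f u) v' = b u (g v').

(** Allows [tensor_ext] to be applied to the second argument of a tensor pairing; [applyr] serves
    for the first. *)
HB.instance Definition _ (K : fieldType) (U V U' V' : lmodType K)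
    (b : {bilinear U -> U' -> K^o}) (c : {bilinear V -> V' -> K^o}) s :=
  GRing.isLinear.Build K (U' ⊗ V') K^o _ (tpair b c s)
    ((tpair_bilinear b c).2 s).

Section AdjointTensor.
Variable K : fieldType.

Lemma tassocK (U V W : lmodType K) : cancel (@tassoc K U V W) (@tassocV K U V W).
Proof.
apply: (tensor_ext (f := @tassocV K U V W \o @tassoc K U V W) (g := idfun)).
move=> r w; move: r; apply: (tensor_ext (g := applyr (@tpure K _ _) w)
  (f := @tassocV K U V W \o @tassoc K U V W \o applyr (@tpure K _ _) w)).
by move=> u v; rewrite /= tassoc_pure tassocV_pure.
Qed.

Lemma tassocVK (U V W : lmodType K) : cancel (@tassocV K U V W) (@tassoc K U V W).
Proof.
apply: (tensor_ext (f := @tassoc K U V W \o @tassocV K U V W) (g := idfun)).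
move=> u; apply: (tensor_ext (g := tpure u)
  (f := @tassoc K U V W \o @tassocV K U V W \o tpure u)).
by move=> v w; rewrite /= tassocV_pure tassoc_pure.
Qed.

Section Basic.
Variables (U V W U' V' W' : lmodType K).

Lemma adjoint_id (b : U -> U' -> K^o) : adjoint b b idfun idfun.
Proof. by []. Qed.

Lemma adjoint_comp (b : U -> U' -> K^o) (c : V -> V' -> K^o)
    (d : W -> W' -> K^o) f f' g g' :
  adjoint b c f f' -> adjoint c d g g' -> adjoint b d (g \o f) (f' \o g').
Proof. by move=> fP gP u w' /=; rewrite gP fP. Qed.

Lemma adjoint_add (b : {bilinear U -> U' -> K^o})
    (c : {bilinear V -> V' -> K^o}) f f' g g' :
  adjoint b c f f' -> adjoint b c g g' -> adjoint b c (f \+ g) (f' \+ g').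
Proof. by move=> fP gP u v' /=; rewrite linearDl linearDr fP gP. Qed.

(** Nondegeneracy on the left: the coordinates of [u] in the basis [e] are themselves values of the
    pairing. *)
Lemma has_dual_bases_eq0 (b : U -> U' -> K^o) u :
  has_dual_bases b -> (forall u', b u u' = 0) -> u = 0.
Proof.
move=> [I [e [e' [eP _]]]] b0.
by rewrite (eP u) big1 // => i _; rewrite b0 scale0r.
Qed.

Lemma has_dual_bases_adjoint (b : {bilinear U -> U' -> K^o})
    (c : {bilinear V -> V' -> K^o}) (f : {linear U -> V}) :
  has_dual_bases b -> exists g : {linear V' -> U'}, adjoint b c f g.
Proof.
move=> [I [e [e' [eP _]]]].
(* The formula is forced: an adjoint must satisfy [b (e i) (g v') = c (f (e i)) v'], and these are
   the coordinates of [g v'] in [e']. *)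
pose g v' := \sum_i c (f (e i)) v' *: e' i.
have g_lin : linear g.
  move=> a x y; rewrite /g scaler_sumr -big_split; apply: eq_bigr => i _ /=.
  by rewrite linearPr scalerDl scalerA.
pose gL : {linear V' -> U'} := HB.pack g (GRing.isLinear.Build K V' U' _ g g_lin).
exists gL => u v'; rewrite /= /g {1}(eP u) linear_sum linear_sumlz linear_sumr.
by apply: eq_bigr => i _; rewrite linearZ linearZl linearZr /= [LHS]mulrC.
Qed.

End Basic.

Lemma adjoint_tmap (U V U' V' X Y X' Y' : lmodType K)
    (b : {bilinear U -> U' -> K^o}) (c : {bilinear V -> V' -> K^o})
    (d : {bilinear X -> X' -> K^o}) (e : {bilinear Y -> Y' -> K^o})
    (f : {linear U -> V}) (f' : {linear V' -> U'})
    (g : {linear X -> Y}) (g' : {linear Y' -> X'}) :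
  adjoint b c f f' -> adjoint d e g g' ->
  adjoint (tpair b d) (tpair c e) (tmap f g) (tmap f' g').
Proof.
move=> fP gP s t; move: s.
apply: (tensor_ext (f := applyr (tpair c e) t \o tmap f g)
  (g := applyr (tpair b d) (tmap f' g' t))) => u x.
rewrite /=; move: t; apply: (tensor_ext (f := tpair c e (tmap f g (u ⊗ₜ x)))
  (g := tpair b d (u ⊗ₜ x) \o tmap f' g')) => v y.
by rewrite /= !tmap_pure !tpair_pure fP gP.
Qed.

Section Assoc.
Variables (U V W U' V' W' : lmodType K).
Variables (b : {bilinear U -> U' -> K^o}) (c : {bilinear V -> V' -> K^o}).
Variable d : {bilinear W -> W' -> K^o}.

Let bc_d := tpair (tpair b c) d.
Let b_cd := tpair b (tpair c d).

Lemma adjoint_tassoc :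
  adjoint bc_d b_cd (@tassoc K U V W) (@tassocV K U' V' W').
Proof.
move=> s t; move: s; apply: (tensor_ext (f := applyr b_cd t \o @tassoc K U V W)
  (g := applyr bc_d (tassocV t))) => r w; move: r.
apply: (tensor_ext
  (f := applyr b_cd t \o @tassoc K U V W \o applyr (@tpure K _ _) w)
  (g := applyr bc_d (tassocV t) \o applyr (@tpure K _ _) w)) => u v.
rewrite /= tassoc_pure; set s' := u ⊗ₜ _; set s := _ ⊗ₜ w.
move: t; apply: (tensor_ext (f := b_cd s')
  (g := bc_d s \o @tassocV K U' V' W')) => u' r.
move: r; apply: (tensor_ext (f := b_cd s' \o tpure u')
  (g := bc_d s \o @tassocV K U' V' W' \o tpure u')) => v' w'.
by rewrite /= tassocV_pure !tpair_pure /= !tpair_pure mulrA.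
Qed.

(** Inverses of adjoint maps are adjoint: write [s] as [tassoc (tassocV s)] and move the outer
    [tassoc] across the pairing. *)
Lemma adjoint_tassocV :
  adjoint b_cd bc_d (@tassocV K U V W) (@tassoc K U' V' W').
Proof.
by move=> s t; rewrite -{2}[s]tassocVK adjoint_tassoc tassocK.
Qed.

End Assoc.
Lemma adjoint_tassoc3 (U V W X U' V' W' X' : lmodType K)
    (b : {bilinear U -> U' -> K^o}) (c : {bilinear V -> V' -> K^o})
    (d : {bilinear W -> W' -> K^o}) (e : {bilinear X -> X' -> K^o}) :
  adjoint (tpair (tpair b (tpair c d)) e) (tpair b (tpair c (tpair d e)))
    (@tassoc3 K U V W X) (@tassoc3V K U' V' W' X').
Proof.
apply: adjoint_comp (adjoint_tassoc _ _ _) _.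
by apply: adjoint_tmap => //; apply: adjoint_tassoc.
Qed.

Lemma adjoint_tassoc3V (U V W X U' V' W' X' : lmodType K)
    (b : {bilinear U -> U' -> K^o}) (c : {bilinear V -> V' -> K^o})
    (d : {bilinear W -> W' -> K^o}) (e : {bilinear X -> X' -> K^o}) :
  adjoint (tpair b (tpair c (tpair d e))) (tpair (tpair b (tpair c d)) e)
    (@tassoc3V K U V W X) (@tassoc3 K U' V' W' X').
Proof.
apply: adjoint_comp (adjoint_tassocV _ _ _).
by apply: adjoint_tmap => //; apply: adjoint_tassocV.
Qed.

(** * Duality between partial associativity and partial coassociativity *)

Section Duality.
Variables (U U' : lmodType K) (b : {bilinear U -> U' -> K^o}).

Let b3 := tpair b (tpair b b).

Lemma adjoint_partially_associative (m : {linear cube U -> U})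
    (D : {linear U' -> cube U'}) :
    has_dual_bases b -> adjoint b3 b m D ->
  partially_coassociative D -> partially_associative m.
Proof.
move=> hb mD D0 t; apply: (has_dual_bases_eq0 hb) => x.
suff H : adjoint (tpair b (tpair b b3)) b
  (m \o ((tmap m idfun \o @tassoc3V K U U U (U ⊗ U))
         \+ tmap idfun (tmap m idfun \o @tassoc3V K U U U U)
         \+ tmap idfun (tmap idfun m)))
  (((@tassoc3 K U' U' U' (U' ⊗ U') \o tmap D idfun)
     \+ tmap idfun (@tassoc3 K U' U' U' U' \o tmap D idfun)
     \+ tmap idfun (tmap idfun D)) \o D).
  by rewrite H D0 linear0r.
(* Adjunction reverses composition, so the outer [m] answers to the inner [D]; the three summands
   are then matched one by one. *)
apply: adjoint_comp (mD).
do 2?apply: adjoint_add.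
- exact: (adjoint_comp (adjoint_tassoc3V _ _ _ _) (adjoint_tmap mD _)).
- apply: adjoint_tmap => //.
  exact: (adjoint_comp (adjoint_tassoc3V _ _ _ _) (adjoint_tmap mD _)).
- by do 2!apply: adjoint_tmap => //.
Qed.

Lemma adjoint_partially_coassociative (D : {linear U -> cube U})
    (m : {linear cube U' -> U'}) :
    has_dual_bases b -> adjoint b b3 D m ->
  partially_associative m -> partially_coassociative D.
Proof.
move=> hb Dm m0 t.
(* The identity lives in the fifth tensor power, whose pairing inherits dual bases from [b]. *)
apply: (has_dual_bases_eq0 (b := tpair b (tpair b b3))) => [|x].
  by do !apply: tpair_dual_bases.
suff H : adjoint b (tpair b (tpair b b3))
  (((@tassoc3 K U U U (U ⊗ U) \o tmap D idfun)
     \+ tmap idfun (@tassoc3 K U U U U \o tmap D idfun)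
     \+ tmap idfun (tmap idfun D)) \o D)
  (m \o ((tmap m idfun \o @tassoc3V K U' U' U' (U' ⊗ U'))
         \+ tmap idfun (tmap m idfun \o @tassoc3V K U' U' U' U')
         \+ tmap idfun (tmap idfun m))).
  by rewrite H m0 linear0r.
apply: adjoint_comp (Dm) _.
do 2?apply: adjoint_add.
- exact: (adjoint_comp (adjoint_tmap Dm _) (adjoint_tassoc3 _ _ _ _)).
- apply: adjoint_tmap => //.
  exact: (adjoint_comp (adjoint_tmap Dm _) (adjoint_tassoc3 _ _ _ _)).
- by do 2!apply: adjoint_tmap => //.
Qed.

End Duality.
End AdjointTensor.

(** * Adjoints for the pairing of a space with its dual *)

Lemma dpair_adjoint (K : fieldType) (P : vectType K) (f : {linear P -> P}) :
  exists g : {linear dual P -> dual P}, adjoint (@dpair K P) (@dpair K P) g f.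
Proof.
(* The transpose of [f]. It passes from [P] to [dual P], whereas [has_dual_bases_adjoint] for
   [dpair] passes from [dual P] to [P]. *)
pose g (xi : dual P) : dual P := linfun (xi \o f : P -> K^o).
have gE xi x : g xi x = xi (f x) by rewrite lfunE.
have g_lin : linear g.
  move=> a xi eta; apply/lfunP => x.
  by rewrite add_lfunE scale_lfunE !gE add_lfunE scale_lfunE.
pose gL : {linear dual P -> dual P} :=
  HB.pack g (GRing.isLinear.Build K (dual P) (dual P) _ g g_lin).
by exists gL => xi x; apply: gE.
Qed.

Section DualPairing.
Variables (K : fieldType) (P : vectType K).
Variables (f : {linear dual P -> dual P}) (g : {linear P -> P}).
Hypothesis fg : adjoint (@dpair K P) (@dpair K P) f g.

Lemma dpair3_tmap1 t s :
  dpair3 (tmap f idfun t) s = dpair3 t (tmap g idfun s).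
Proof. exact: (adjoint_tmap fg (adjoint_id _)). Qed.

Lemma dpair3_tmap2 t s :
  dpair3 (tmap idfun (tmap f idfun) t) s
  = dpair3 t (tmap idfun (tmap g idfun) s).
Proof.
exact: (adjoint_tmap (adjoint_id _) (adjoint_tmap fg (adjoint_id _))).
Qed.

Lemma dpair3_tmap3 t s :
  dpair3 (tmap idfun (tmap idfun f) t) s
  = dpair3 t (tmap idfun (tmap idfun g) s).
Proof.
exact: (adjoint_tmap (adjoint_id _) (adjoint_tmap (adjoint_id _) fg)).
Qed.

End DualPairing.

(** * Compatibility on the dual, and the dual bialgebra *)

Section DualBialgebra.
Variables (K : fieldType) (P : vectType K).
Variables (mu : {linear cube P -> P}) (Delta : {linear P -> cube P}).

Lemma dual_infinitesimal_compatible :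
  infinitesimal_compatible mu Delta ->
  infinitesimal_compatible (dual_prod Delta) (dual_coprod mu).
Proof.
move=> compat xi eta gamma.
apply: (is_dual_coprod_inj (dual_coprodP _ _)) => x y z.
(* The summands of the dual side are reversed, so that [opR], [opM], [opL] there face [opL], [opM],
   [opR] of [mu]. *)
rewrite dual_prodE compat !linearDr !linearDl /= addrC addrA addrAC.
have dbP := dpair_dual_bases P.
congr (_ + _ + _).
- have [g gP] := has_dual_bases_adjoint (@dpair K P)
    (opR (dual_prod Delta) eta gamma) dbP.
  have [f fP] := dpair_adjoint (opL mu x y).
  rewrite (dpair3_tmap3 gP).
  rewrite -(dpair3_tmap1 fP) !tmap_pure /= !tmap_pure dual_coprodE.
  (* Both sides are [xi (mu (x, y, g z))]: the right one is the product of [f xi], [eta], [gamma] at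
     [z], hence [f xi] at [g z], and [f] is the transpose of [opL mu x y]. *)
  by rewrite -dual_prodE -[RHS]/(dpair (opR _ _ _ _) z) gP; apply/esym/fP.
- have [g gP] := has_dual_bases_adjoint (@dpair K P)
    (opM (dual_prod Delta) xi gamma) dbP.
  have [f fP] := dpair_adjoint (opM mu x z).
  rewrite (dpair3_tmap2 gP).
  rewrite -(dpair3_tmap2 fP).
  rewrite !tmap_pure /= !tmap_pure dual_coprodE.
  by rewrite -dual_prodE -[RHS]/(dpair (opM _ _ _ _) y) gP; apply/esym/fP.
- have [g gP] := has_dual_bases_adjoint (@dpair K P)
    (opL (dual_prod Delta) xi eta) dbP.
  have [f fP] := dpair_adjoint (opR mu y z).
  rewrite (dpair3_tmap1 gP).
  rewrite -(dpair3_tmap3 fP).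
  rewrite !tmap_pure /= !tmap_pure dual_coprodE.
  by rewrite -dual_prodE -[RHS]/(dpair (opL _ _ _ _) x) gP; apply/esym/fP.
Qed.

End DualBialgebra.

Theorem theorem4p8 (K : fieldType) (charK0 : [pchar K]%R =i pred0)
    (P : vectType K)
    (mu : {linear cube P -> P}) (Delta : {linear P -> cube P})
    (bialgP : pa3_inf_bialgebra mu Delta) :
  pa3_inf_bialgebra (dual_prod Delta) (dual_coprod mu).
Proof.
have [assoc coassoc compat] := bialgP; have hP := dpair_dual_bases P.
split; last exact: dual_infinitesimal_compatible.
- apply: (adjoint_partially_associative hP) coassoc => t x.
  exact: dual_prodE.
- apply: (adjoint_partially_coassociative hP) assoc => xi t.
  exact: dual_coprodE.
Qed.
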